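(* Let $k,r\ge 1$ be integers, $p\in(0,1)$, $q=1-p$. Let $Y$ be the waiting time for the $r$-th nonoverlapping success run of length $k$ (negative binomial distribution $\mathrm{NB}_{k,r}$ of Type I). Then for every integer $n\ge rk$, $$\mathbb{P}(Y=n)=p^{rk}\sum_{j=0}^{n-rk}(-1)^{n-rk-j}p^{n-rk-j}\binom{r}{n-rk-j}\sum_{i=0}^{\lfloor j/(k+1)\rfloor}(-1)^iq^ip^{ik}\binom{r+i-1}{r-1}\binom{r+j-ik-1}{r+i-1}.$$
   Context: Consider independent Bernoulli trials, indexed $1,2,3,\dots$, each with success probability $p$. Success runs of length $k$ are counted in the nonoverlapping sense: as soon as $k$ consecutive successes are attained, a run is counted and the counting for a new run begins from scratch with the next trial. $Y$ is the index of the trial at which the $r$-th such run is completed; equivalently, $Y$ is the sum of $r$ independent copies of the waiting time for the first run of $k$ consecutive successes. Its probability generating function is $\left(\frac{p^ks^k(1-ps)}{1-s+qp^ks^{k+1}}\right)^r$. Convention: $\binom{a}{b}=0$ unless $0\le b\le a$. *)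

(* Defs.v *)
From HB Require Import structures.
From mathcomp Require Import all_boot all_order all_algebra.
From mathcomp Require Import finmap.
From mathcomp Require Import all_classical all_reals all_analysis.

Set Implicit Arguments.
Unset Strict Implicit.
Unset Printing Implicit Defensive.

Import Order.TTheory GRing.Theory Num.Theory.
Import numFieldNormedType.Exports.

Local Open Scope classical_set_scope.
Local Open Scope ring_scope.

(* The product rule is required for every finite subfamily J and all measurable
   sets B i. *)
Definition mutually_independent (d d' : measure_display)
    (T : measurableType d) (T' : measurableType d') (R : realType)
    (P : probability T R) (I : choiceType) (X : I -> {RV P >-> T'}) : Prop :=
  forall (J : {fset I}) (B : I -> set T'),
    (forall i, measurable (B i)) ->
    P (\bigcap_(i in [set` J]) (X i @^-1` B i)) =
    (\prod_(i <- J) P (X i @^-1` B i))%E.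

(* An outcome is a sequence x : nat -> bool in which x i is the result of trial
   number i.+1 (trials are numbered from 1).  After the first n trials,
   run_state k x n = (c, l), where c is the number of nonoverlapping success
   runs of length k completed so far and l is the length of the current streak
   of successes, counted from scratch after each completed run. *)
Fixpoint run_state (k : nat) (x : nat -> bool) (n : nat) : nat * nat :=
  if n is m.+1 then
    let: (c, l) := run_state k x m in
    if x m then
      if l.+1 == k then (c.+1, 0%N) else (c, l.+1)
    else (c, 0%N)
  else (0%N, 0%N).

Definition nb_runs (k : nat) (x : nat -> bool) (n : nat) : nat :=
  (run_state k x n).1.

(* None means that fewer than r runs are ever completed. *)
Definition run_waiting_time (k r : nat) (x : nat -> bool) : option nat :=
  match pselect (exists n, (r <= nb_runs k x n)%N) with
  | left h => Some (ex_minn h)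
  | right _ => None
  end.

(* Main.v *)
Require Import Defs.
From HB Require Import structures.
From mathcomp Require Import all_boot all_order all_algebra.
From mathcomp Require Import finmap.
From mathcomp Require Import all_classical all_reals all_analysis.
From mathcomp Require Import ring zify.

Set Implicit Arguments.
Unset Strict Implicit.
Unset Printing Implicit Defensive.

Import Order.TTheory GRing.Theory Num.Theory.
Import numFieldNormedType.Exports.

Local Open Scope classical_set_scope.
Local Open Scope ring_scope.

(** The r-th run is completed at trial n.+1 exactly when after n trials r.-1
    runs are complete, the current streak has length k.-1, and the next trial
    succeeds ([run_waiting_timeS]).  A streak of l < k successes must follow a
    moment at which counting started afresh, so every probability of this kind
    is a power of p times u m c, the probability that after m trials the run
    state is (c, 0) ([run_state_streak_prob], [run_completion_prob]).

    Let v m c be the probability of c completed runs after m trials, and let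
    U c and V c be the generating series, in the variable s, of u and v in m.
    Write W c = p^k s^k U c for the series of the trial at which run c + 1 is
    completed, and e c = W (c - 1), with e 0 = 1.  A fresh start comes from the
    initial state, from a failure or from the completion of a run, and the
    number of completed runs changes only at a completion; as the outcome of a
    trial is independent of the earlier ones, this says
      U c = e c + q s V c    and    (1 - s) V c = e c - W c.
    Eliminating V c, and using q = 1 - p, gives
      (1 - s + q p^k s^(k+1)) U c = (1 - p s) e c,
    whence U c = (1 - p s)^(c+1) (p^k s^k)^c / (1 - s + q p^k s^(k+1))^(c+1).

    The two sums of the theorem are this Cauchy product for c = r - 1: the
    outer one comes from (1 - p s)^r, and the inner one from expanding
    (1 - s + E)^-r in powers of E = q p^k s^(k+1), and then each (1 - s)^-(r+i)
    by the negative binomial series ([run_recurrence_solution],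
    [coef_perturbed_inverse]).  Power series are represented by polynomials
    modulo a power of 'X that exceeds every degree of interest.

    On the probabilistic side, the independence of a trial from any event
    determined by the earlier ones ([trial_event_independent]) is obtained by
    freezing the trials one after the other, from the last to the first. *)

(** * Negative binomial expansions modulo a power of 'X *)

(** The partial sum of the negative binomial series of (1 - z)^-(m+1). *)
Definition inv_pow_trunc (A : comNzRingType) (N m : nat) (z : A) : A :=
  \sum_(j < N) 'C(m + j, m)%:R * z ^+ j.

(** Telescoping by Pascal's rule: one factor 1 - z lowers the exponent by one, up
    to a boundary term. *)
Lemma inv_pow_truncS (A : comNzRingType) (N m : nat) (z : A) :
  (1 - z) * inv_pow_trunc N m.+1 z = inv_pow_trunc N m z - 'C(m + N, m.+1)%:R * z ^+ N.
Proof.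
rewrite /inv_pow_trunc; elim: N => [|N IHN].
  by rewrite !big_ord0 addn0 bin_small // mulr0 mul0r subr0.
rewrite !big_ord_recr /= mulrDr IHN addSn addnS !binS !natrD exprS.
ring.
Qed.

(** Stated in an arbitrary commutative ring because it serves both at z = 'X and at
    a polynomial z that is merely divisible by 'X. *)
Lemma inv_pow_truncE (A : comNzRingType) (N m : nat) (z : A) :
  exists w, (1 - z) ^+ m.+1 * inv_pow_trunc N m z = 1 - z ^+ N * w.
Proof.
elim: m => [|m [w IHm]].
  exists 1; rewrite expr1 mulr1 /inv_pow_trunc.
  under eq_bigr => j _ do rewrite bin0 mul1r.
  have := subrX1 z N; rewrite -opprB => /(canRL (@opprK _)) ->.
  by rewrite -mulNr opprB.
exists (w + (1 - z) ^+ m.+1 * 'C(m + N, m.+1)%:R).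
rewrite exprSr -mulrA inv_pow_truncS mulrBr IHm.
ring.
Qed.

Definition eqmodX (F : fieldType) (N : nat) (A B : {poly F}) : bool :=
  'X^N %| A - B.

Lemma eqmodXP (F : fieldType) (N : nat) (A B : {poly F}) :
  reflect (forall i, (i < N)%N -> A`_i = B`_i) (eqmodX N A B).
Proof.
apply: (iffP idP) => [/dvdpP[C eC] i iN | eAB].
  by apply/eqP; rewrite -subr_eq0 -coefB eC coefMXn iN.
rewrite /eqmodX; apply/dvdpP; exists (drop_poly N (A - B)).
rewrite -{1}(poly_take_drop N (A - B)) -[RHS]add0r; congr (_ + _).
apply/polyP => i; rewrite coef_take_poly coef0 coefB.
by case: ltnP => // /eAB ->; rewrite subrr.
Qed.

Lemma eqmodX_refl (F : fieldType) (N : nat) (A : {poly F}) : eqmodX N A A.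
Proof. exact/eqmodXP. Qed.

Lemma eqmodX_sym (F : fieldType) (N : nat) (A B : {poly F}) :
  eqmodX N A B -> eqmodX N B A.
Proof. by move/eqmodXP => h; apply/eqmodXP => i /h. Qed.

Lemma eqmodX_trans (F : fieldType) (N : nat) (B A C : {poly F}) :
  eqmodX N A B -> eqmodX N B C -> eqmodX N A C.
Proof.
by move=> /eqmodXP h1 /eqmodXP h2; apply/eqmodXP => i iN; rewrite h1 ?h2.
Qed.

Lemma eqmodXD (F : fieldType) (N : nat) (A B A' B' : {poly F}) :
  eqmodX N A A' -> eqmodX N B B' -> eqmodX N (A + B) (A' + B').
Proof. by rewrite /eqmodX opprD addrACA; exact: dvdp_add. Qed.

Lemma eqmodXM (F : fieldType) (N : nat) (A B A' B' : {poly F}) :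
  eqmodX N A A' -> eqmodX N B B' -> eqmodX N (A * B) (A' * B').
Proof.
rewrite /eqmodX => hA hB.
have -> : A * B - A' * B' = (A - A') * B + A' * (B - B') by ring.
by apply: dvdp_add; [exact: dvdp_mulr | exact: dvdp_mull].
Qed.

Lemma eqmodXMl (F : fieldType) (N : nat) (C A A' : {poly F}) :
  eqmodX N A A' -> eqmodX N (C * A) (C * A').
Proof. exact/eqmodXM/eqmodX_refl. Qed.

Lemma eqmodXX (F : fieldType) (N m : nat) (A A' : {poly F}) :
  eqmodX N A A' -> eqmodX N (A ^+ m) (A' ^+ m).
Proof.
move=> h; elim: m => [|m IHm]; first exact: eqmodX_refl.
by rewrite !exprS; apply: eqmodXM.
Qed.

Lemma eqmodX_inv_pow_trunc (F : fieldType) (N m : nat) (z : {poly F}) :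
  'X %| z -> eqmodX N ((1 - z) ^+ m.+1 * inv_pow_trunc N m z) 1.
Proof.
move=> /(dvdp_exp2r N) Xz; have [w ->] := inv_pow_truncE N m z.
by rewrite /eqmodX addrAC subrr add0r dvdpNr dvdp_mulr.
Qed.

Lemma eqmodX_inv_unique (F : fieldType) (N : nat) (A B C : {poly F}) :
  eqmodX N (A * B) 1 -> eqmodX N (A * C) 1 -> eqmodX N B C.
Proof.
move=> hB hC; apply: (@eqmodX_trans _ _ (A * C * B)).
  by rewrite -{1}[B]mul1r; apply: eqmodXM (eqmodX_sym hC) (eqmodX_refl _ _).
by rewrite mulrAC -{2}[C]mul1r; apply: eqmodXM hB (eqmodX_refl _ _).
Qed.

Lemma inv_pow_truncX_eqmodX (F : fieldType) (N m : nat) :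
  eqmodX N (inv_pow_trunc N m 'X) ((inv_pow_trunc N 0 'X : {poly F}) ^+ m.+1).
Proof.
apply: (@eqmodX_inv_unique _ _ ((1 - 'X) ^+ m.+1)).
  exact: eqmodX_inv_pow_trunc.
rewrite -exprMn -[X in eqmodX _ _ X](expr1n _ m.+1); apply: eqmodXX.
by rewrite -{1}[1 - 'X]expr1; apply: eqmodX_inv_pow_trunc.
Qed.

(** The expansion of (1 - 'X + E)^-(m+1) in powers of the perturbation E; the
    coefficient of (- E) ^+ i is 'C(m + i, m) times (1 - 'X)^-(m+i+1). *)
Definition perturbed_inverse (F : fieldType) (N m : nat) (E : {poly F}) :=
  \sum_(i < N) 'C(m + i, m)%:R * (- E) ^+ i * inv_pow_trunc N (m + i) 'X.

Lemma eqmodX_sum (F : fieldType) (N n : nat) (A B : 'I_n -> {poly F}) :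
  (forall i, eqmodX N (A i) (B i)) -> eqmodX N (\sum_i A i) (\sum_i B i).
Proof.
move=> h; apply: (big_ind2 (eqmodX N)) => // [|? ? ? ?]; last exact: eqmodXD.
exact: eqmodX_refl.
Qed.

(** Modulo 'X^N, with G the inverse of 1 - 'X and z = - E * G, the base
    1 - 'X + E factors as (1 - 'X) * (1 - z), and the expansion is G ^+ m.+1 times
    the negative binomial series of z.  As 'X divides z, the error z ^+ N of that
    series vanishes. *)
Lemma perturbed_inverseP (F : fieldType) (N m : nat) (E : {poly F}) :
  'X %| E ->
  eqmodX N ((1 - 'X + E) ^+ m.+1 * perturbed_inverse N m E) 1.
Proof.
move=> XE; pose G : {poly F} := inv_pow_trunc N 0 'X; pose z := - E * G.
have XG : eqmodX N ((1 - 'X) * G) 1.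
  by rewrite -{1}[1 - 'X]expr1; apply: eqmodX_inv_pow_trunc.
have hD : eqmodX N (1 - 'X + E) ((1 - 'X) * (1 - z)).
  have -> : (1 - 'X) * (1 - z) = 1 - 'X + E * ((1 - 'X) * G).
    by rewrite /z; ring.
  apply: eqmodXD (eqmodX_refl _ _) _; rewrite -{1}[E]mulr1.
  exact/eqmodXMl/eqmodX_sym.
have hQ : eqmodX N (perturbed_inverse N m E) (G ^+ m.+1 * inv_pow_trunc N m z).
  rewrite /inv_pow_trunc mulr_sumr; apply: eqmodX_sum => i.
  apply: (@eqmodX_trans _ _ ('C(m + i, m)%:R * (- E) ^+ i * G ^+ (m + i).+1)).
    exact/eqmodXMl/inv_pow_truncX_eqmodX.
  rewrite /z exprMn -addSn exprD.
  have -> (a b c e : {poly F}) : a * b * (c * e) = c * (a * (b * e)) by ring.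
  exact: eqmodX_refl.
apply: eqmodX_trans (eqmodXM (eqmodXX m.+1 hD) hQ) _.
rewrite exprMn mulrACA -exprMn -[X in eqmodX _ _ X]mulr1; apply: eqmodXM.
  by rewrite -[X in eqmodX _ _ X](expr1n _ m.+1); apply: eqmodXX.
by apply: eqmodX_inv_pow_trunc; rewrite /z dvdp_mulr // dvdpNr.
Qed.

Lemma coef_inv_pow_truncX (F : fieldType) (N m j : nat) : (j < N)%N ->
  (inv_pow_trunc N m 'X : {poly F})`_j = 'C(m + j, m)%:R.
Proof.
move=> jN; rewrite /inv_pow_trunc.
under eq_bigr => i _ do rewrite -polyC_natr mul_polyC.
by rewrite -(poly_def N (fun i => 'C(m + i, m)%:R)) coef_poly jN.
Qed.

(** The i-th term starts in degree i * k.+1, which bounds the range of i; it uses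
    the coefficient of degree j - i * k.+1 of the series of (1 - 'X)^-(m+i+1). *)
Lemma coef_perturbed_inverse (F : fieldType) (N m k : nat) (a : F) (j : nat) :
  (j < N)%N ->
  (perturbed_inverse N m (a *: 'X^(k.+1)))`_j =
  \sum_(0 <= i < (j %/ k.+1).+1)
    (- a) ^+ i * 'C(m + i, m)%:R * 'C(m + j - i * k, m + i)%:R.
Proof.
move=> jN; rewrite /perturbed_inverse coef_sum.
pose t i : F := if (i * k.+1 <= j)%N then
  (- a) ^+ i * 'C(m + i, m)%:R * 'C(m + j - i * k, m + i)%:R else 0.
rewrite (eq_bigr (fun i : 'I_N => t i)); last first.
  move=> i _; rewrite -scaleNr exprZn -exprM -polyC_natr mul_polyC.
  rewrite scalerA -scalerAl coefZ coefXnM mulnC /t ltnNge.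
  case: leqP => /= [ij|_]; last by rewrite mulr0.
  rewrite coef_inv_pow_truncX; last by lia.
  rewrite [in 'C(m + i, m)%:R * _]mulrC; congr (_ * 'C(_, _)%:R).
  by lia.
rewrite -(big_mkord xpredT t) (big_cat_nat _ (n := (j %/ k.+1).+1)) //=; last first.
  by apply: leq_ltn_trans jN; apply: leq_div.
rewrite [X in _ + X]big_nat_cond [X in _ + X]big1 ?addr0; last first.
  by move=> i /andP[/andP[+ _] _]; rewrite /t ltn_divLR // ltnNge => /negbTE ->.
apply: eq_big_nat => i /andP[_]; rewrite ltnS leq_divRL // /t => -> //.
Qed.

Lemma coef_1subXn (F : fieldType) (p : F) (r l : nat) :
  ((1 - p *: 'X) ^+ r)`_l = (-1) ^+ l * p ^+ l * 'C(r, l)%:R.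
Proof.
rewrite exprDn.
under eq_bigr => i _ do
  rewrite expr1n mul1r -scaleNr exprZn -scaler_nat scalerA.
rewrite -(poly_def r.+1 (fun i => 'C(r, i)%:R * (- p) ^+ i)) coef_poly ltnS.
rewrite -exprMn mulN1r mulrC.
by case: leqP => // rl; rewrite bin_small // mulr0.
Qed.

(** * The recurrence for fresh starts *)

(** Events about the previously completed run have no counterpart when c = 0. *)
Definition prev_or0 (F : fieldType) (f : nat -> F) (c : nat) : F :=
  if c is c'.+1 then f c' else 0.

(** Here a m c stands for the probability that run c + 1 is completed at trial m + 1,
    and the polynomials U, V, W and e below are truncated generating functions:
    the coefficient of degree m.+1 of W c is a m c.  The recurrences become linear
    relations modulo 'X^N, from which V is eliminated. *)
Lemma run_recurrence_solution (F : fieldType) (k : nat) (p q : F)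
    (u v a : nat -> nat -> F) (hk : (0 < k)%N) (hq : q = 1 - p)
    (u0 : forall c, u 0%N c = (c == 0%N)%:R)
    (v0 : forall c, v 0%N c = (c == 0%N)%:R)
    (aE : forall m c, a m c = if (k <= m.+1)%N then p ^+ k * u (m.+1 - k)%N c else 0)
    (uS : forall m c, u m.+1 c = q * v m c + prev_or0 (a m) c)
    (vS : forall m c, v m.+1 c = v m c - a m c + prev_or0 (a m) c)
    (n c : nat) (hn : (c * k <= n)%N) :
  u n c = p ^+ (c * k) *
    \sum_(0 <= j < (n - c * k).+1)
     ((-1) ^+ (n - c * k - j) * p ^+ (n - c * k - j) *
      'C(c.+1, n - c * k - j)%:R *
      \sum_(0 <= i < (j %/ k.+1).+1)
        ((- (q * p ^+ k)) ^+ i * 'C(c + i, c)%:R * 'C(c + j - i * k, c + i)%:R)).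
Proof.
pose N := n.+1.
pose U c := \poly_(i < N) u i c.
pose V c := \poly_(i < N) v i c.
pose W c := (p ^+ k) *: ('X^k * U c).
pose e c := if c is c'.+1 then W c' else 1.
pose E := (q * p ^+ k) *: 'X^(k.+1).
have XE : 'X %| E by rewrite /E -mul_polyC dvdp_mull // exprS dvdp_mulr.
have W0 b : (W b)`_0 = 0 by rewrite coefZ coefXnM hk mulr0.
have WS b m : (m.+1 < N)%N -> (W b)`_m.+1 = a m b.
  move=> mN; rewrite coefZ coefXnM aE ltnNge; case: leqP => /= hm.
    by rewrite coef_poly (leq_ltn_trans (leq_subr _ _) mN).
  by rewrite mulr0.
have e0 b : (e b)`_0 = (b == 0)%:R by case: b => [|b] /=; rewrite ?coef1 ?W0.
have eS b m : (m.+1 < N)%N -> (e b)`_m.+1 = prev_or0 (a m) b.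
  by move=> mN; case: b => [|b] /=; rewrite ?coef1 ?WS.
have eV b : eqmodX N ((1 - 'X) * V b) (e b - W b).
  apply/eqmodXP => -[|m] mN; rewrite mulrBl mul1r !coefB coefXM !coef_poly /=.
    by rewrite v0 e0 W0.
  by rewrite mN (ltnW mN) eS // WS // vS; ring.
have eU b : eqmodX N (U b) (e b + (q *: 'X) * V b).
  apply/eqmodXP => -[|m] mN; rewrite -scalerAl coefD coefZ coefXM !coef_poly /=.
    by rewrite u0 e0 mulr0 addr0.
  by rewrite mN (ltnW mN) eS // uS addrC.
have DU b : eqmodX N ((1 - 'X + E) * U b) ((1 - p *: 'X) * e b).
  have -> : (1 - 'X + E) * U b = (1 - 'X) * U b + (q *: 'X) * W b.
    rewrite mulrDl /E /W; congr (_ + _).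
    by rewrite -scalerAl -scalerAr -scalerAl scalerA exprS !mulrA mulrC.
  have -> : (1 - p *: 'X) * e b =
     (1 - 'X) * e b + (q *: 'X) * (e b - W b) + (q *: 'X) * W b.
    by rewrite hq scalerBl scale1r; ring.
  apply: eqmodXD (eqmodX_refl _ _).
  apply: eqmodX_trans (eqmodXMl (1 - 'X) (eU b)) _.
  rewrite mulrDr; apply: eqmodXD (eqmodX_refl _ _) _.
  by rewrite mulrCA; apply: eqmodXMl.
have DUn b : eqmodX N ((1 - 'X + E) ^+ b.+1 * U b)
                 ((1 - p *: 'X) ^+ b.+1 * (p ^+ k *: 'X^k) ^+ b).
  elim: b => [|b IHb]; first by rewrite !expr1 expr0; exact: DU.
  rewrite exprSr -mulrA; apply: eqmodX_trans (eqmodXMl _ (DU b.+1)) _.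
  rewrite /= /W.
  have -> : (1 - 'X + E) ^+ b.+1 * ((1 - p *: 'X) * (p ^+ k *: ('X^k * U b))) =
     (1 - p *: 'X) * (p ^+ k *: 'X^k) * ((1 - 'X + E) ^+ b.+1 * U b).
    by rewrite [p ^+ k *: (_ * _)]scalerAl; ring.
  have -> : (1 - p *: 'X) ^+ b.+2 * (p ^+ k *: 'X^k) ^+ b.+1 =
     (1 - p *: 'X) * (p ^+ k *: 'X^k) *
     ((1 - p *: 'X) ^+ b.+1 * (p ^+ k *: 'X^k) ^+ b).
    by rewrite [_ ^+ b.+2]exprS [(_ *: _) ^+ b.+1]exprS; ring.
  exact: eqmodXMl.
have UE : eqmodX N (U c) ((p ^+ k *: 'X^k) ^+ c *
     ((1 - p *: 'X) ^+ c.+1 * perturbed_inverse N c E)).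
  apply: (@eqmodX_trans _ _ (perturbed_inverse N c E * ((1 - 'X + E) ^+ c.+1 * U c))).
    rewrite mulrA -{1}[U c]mul1r; apply: eqmodXM (eqmodX_refl _ _).
    by rewrite mulrC; apply/eqmodX_sym/perturbed_inverseP.
  apply: eqmodX_trans (eqmodXMl _ (DUn c)) _.
  by rewrite mulrC mulrAC [X in eqmodX _ X _]mulrC; apply: eqmodX_refl.
have /eqmodXP/(_ n (ltnSn n)) := UE; rewrite coef_poly ltnSn => ->.
rewrite exprZn -!exprM -scalerAl coefZ coefXnM mulnC ltnNge hn /=.
congr (_ * _); rewrite coefMr [RHS]big_mkord; apply: eq_bigr => j _.
rewrite coef_1subXn coef_perturbed_inverse //.
by have := ltn_ord j; rewrite /N; lia.
Qed.

(** * Events determined by finitely many trials *)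

Definition determined_by_first (m : nat) (phi : (nat -> bool) -> bool) : Prop :=
  forall x y, (forall i, (i < m)%N -> x i = y i) -> phi x = phi y.

Lemma determined_by_firstW (m n : nat) (phi : (nat -> bool) -> bool) :
  (m <= n)%N -> determined_by_first m phi -> determined_by_first n phi.
Proof. by move=> mn h x y xy; apply: h => i im; apply/xy/(leq_trans im). Qed.

Definition fix_trial (m : nat) (b : bool) (phi : (nat -> bool) -> bool)
    (x : nat -> bool) : bool :=
  phi (fun i => if i == m then b else x i).

Lemma fix_trial_determined (m : nat) (b : bool) (phi : (nat -> bool) -> bool) :
  determined_by_first m.+1 phi -> determined_by_first m (fix_trial m b phi).
Proof.
move=> h x y xy; apply: h => i; rewrite ltnS leq_eqVlt.
by case: eqP => //= _; apply: xy.
Qed.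

Definition trial_event (R : realType) (d : measure_display)
    (T : measurableType d) (P : probability T R) (X : nat -> {RV P >-> bool})
    (phi : (nat -> bool) -> bool) : set T :=
  [set t | phi (fun i => X i t)].

Lemma trial_event_determined0 (R : realType) (d : measure_display)
    (T : measurableType d) (P : probability T R) (X : nat -> {RV P >-> bool})
    (phi : (nat -> bool) -> bool) :
  determined_by_first 0 phi ->
  trial_event X phi = setT \/ trial_event X phi = set0.
Proof.
move=> h; have e t : phi (fun i => X i t) = phi (fun=> false) by exact: h.
case hphi: (phi (fun=> false)); [left | right].
  by apply/seteqP; split => // t _; rewrite /trial_event /= e hphi.
by apply/seteqP; split => // t; rewrite /trial_event /= e hphi.
Qed.

(** Once the outcome of trial m is known, the event depends on fewer trials; this is
    the induction step for measurability and for independence. *)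
Lemma trial_event_split (R : realType) (d : measure_display)
    (T : measurableType d) (P : probability T R) (X : nat -> {RV P >-> bool})
    (m : nat) (phi : (nat -> bool) -> bool) :
  determined_by_first m.+1 phi ->
  trial_event X phi =
  (trial_event X (fix_trial m true phi) `&` X m @^-1` [set true]) `|`
  (trial_event X (fix_trial m false phi) `&` X m @^-1` [set false]).
Proof.
move=> h.
have e t b : X m t = b ->
    fix_trial m b phi (fun i => X i t) = phi (fun i => X i t).
  by move=> <-; apply: h => i _; case: eqP => [->|].
apply/seteqP; split => t; rewrite /trial_event /=.
  by case Xm: (X m t) => ht; [left | right]; rewrite e.
by move=> [[+ Xm]|[+ Xm]]; rewrite e.
Qed.

Lemma trial_event_measurable (R : realType) (d : measure_display)
    (T : measurableType d) (P : probability T R) (X : nat -> {RV P >-> bool})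
    (m : nat) (phi : (nat -> bool) -> bool) :
  determined_by_first m phi -> measurable (trial_event X phi).
Proof.
elim: m phi => [|m IHm] phi h.
  by case: (trial_event_determined0 X h) => ->.
rewrite (trial_event_split X h).
apply: measurableU; apply: measurableI.
- exact/IHm/fix_trial_determined.
- exact: measurable_funPTI.
- exact/IHm/fix_trial_determined.
- exact: measurable_funPTI.
Qed.

(** The finite family J of later trials is arbitrary because the induction on m
    moves trial m into it: the event is split according to the outcome of trial m,
    and the induction hypothesis is applied to the family with m added. *)
Lemma trial_event_independent (R : realType) (d : measure_display)
    (T : measurableType d) (P : probability T R) (X : nat -> {RV P >-> bool})
    (Xindep : mutually_independent X) (m : nat) (phi : (nat -> bool) -> bool)
    (J : {fset nat}) (B : nat -> set bool) :
  determined_by_first m phi ->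
  (forall i, i \in J -> (m <= i)%N) ->
  P (trial_event X phi `&` \bigcap_(i in [set` J]) (X i @^-1` B i)) =
  (P (trial_event X phi) * \prod_(i <- J) P (X i @^-1` B i))%E.
Proof.
have mB (i : nat) (C : set bool) : measurable (X i @^-1` C).
  exact: measurable_funPTI.
elim: m phi J B => [|m IHm] phi J B h hJ.
  case: (trial_event_determined0 X h) => ->.
    by rewrite setTI probability_setT mul1e Xindep.
  by rewrite set0I measure0 mul0e.
pose w b := (P (trial_event X (fix_trial m b phi)) * P (X m @^-1` [set b]))%E.
suff main (K : {fset nat}) : (forall i, i \in K -> (m.+1 <= i)%N) ->
    P (trial_event X phi `&` \bigcap_(i in [set` K]) (X i @^-1` B i)) =
    ((w true + w false) * \prod_(i <- K) P (X i @^-1` B i))%E.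
  rewrite main //; congr (_ * _)%E.
  (* The empty family gives the probability of the event itself. *)
  have := main fset0 (fun _ => _).
  rewrite set_fset0 bigcap_set0 setIT big_seq_fset0 mule1 => -> //.
move=> hK; pose C := \bigcap_(i in [set` K]) (X i @^-1` B i).
have mC : measurable C by rewrite /C; apply: fin_bigcap_measurable.
have mK : m \notin K by apply/negP => /hK; rewrite ltnn.
have half b : P ((trial_event X (fix_trial m b phi) `&` X m @^-1` [set b]) `&` C)
   = (w b * \prod_(i <- K) P (X i @^-1` B i))%E.
  (* B' prescribes the outcome b at trial m and agrees with B on K. *)
  pose B' i := if i == m then [set b] else B i.
  have := IHm (fix_trial m b phi) (m |` K)%fset B' (fix_trial_determined b h).
  rewrite bigcap_fsetU1 big_fsetU1 //= {1 3}/B' eqxx setIA muleA.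
  have -> : \bigcap_(i in [set` K]) X i @^-1` B' i = C.
    apply: eq_bigcapr => i /= iK; rewrite /B'.
    by case: eqP iK mK => // -> ->.
  have -> : (\prod_(i <- K) P (X i @^-1` B' i) =
             \prod_(i <- K) P (X i @^-1` B i))%E.
    rewrite !big_seq; apply: eq_bigr => i iK; rewrite /B'.
    by case: eqP iK mK => // -> ->.
  by apply=> i; rewrite !inE => /orP[/eqP -> //|/hK]; exact: ltnW.
rewrite (trial_event_split X h) setIUl -/C measureU.
- rewrite ge0_muleDl ?mule_ge0 //.
  exact: (congr2 _ (half true) (half false)).
- by apply: measurableI => //; apply: measurableI => //;
    apply: trial_event_measurable; apply: fix_trial_determined.
- by apply: measurableI => //; apply: measurableI => //;
    apply: trial_event_measurable; apply: fix_trial_determined.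
- by apply/seteqP; split => // t [[[_ /= ->] _] [[_ /= ]]].
Qed.

(** Real-valued, so that the recurrences can be handled by ring identities. *)
Definition trial_prob (R : realType) (d : measure_display)
    (T : measurableType d) (P : probability T R) (X : nat -> {RV P >-> bool})
    (phi : (nat -> bool) -> bool) : R :=
  fine (P (trial_event X phi)).

Lemma eq_trial_prob (R : realType) (d : measure_display)
    (T : measurableType d) (P : probability T R) (X : nat -> {RV P >-> bool})
    (phi psi : (nat -> bool) -> bool) :
  phi =1 psi -> trial_prob X phi = trial_prob X psi.
Proof. by move=> /funext ->. Qed.

Lemma trial_prob_pred0 (R : realType) (d : measure_display)
    (T : measurableType d) (P : probability T R) (X : nat -> {RV P >-> bool})
    (phi : (nat -> bool) -> bool) :
  (forall x, phi x = false) -> trial_prob X phi = 0.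
Proof.
move=> h; rewrite /trial_prob (_ : trial_event X phi = set0) ?measure0 //.
by apply/seteqP; split => // t; rewrite /trial_event /= h.
Qed.

Lemma trial_prob_predT (R : realType) (d : measure_display)
    (T : measurableType d) (P : probability T R) (X : nat -> {RV P >-> bool})
    (phi : (nat -> bool) -> bool) :
  (forall x, phi x) -> trial_prob X phi = 1.
Proof.
move=> h; rewrite /trial_prob (_ : trial_event X phi = setT) ?probability_setT //.
by apply/seteqP; split => // t _; rewrite /trial_event /= h.
Qed.

Lemma trial_prob_split (R : realType) (d : measure_display)
    (T : measurableType d) (P : probability T R) (X : nat -> {RV P >-> bool})
    (m : nat) (phi psi : (nat -> bool) -> bool) :
  determined_by_first m phi -> determined_by_first m psi ->
  trial_prob X phi = trial_prob X (fun x => phi x && psi x) +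
                     trial_prob X (fun x => phi x && ~~ psi x).
Proof.
move=> hphi hpsi; rewrite /trial_prob -fineD; last 2 first.
- apply/fin_num_measure/(@trial_event_measurable _ _ _ _ _ m) => x y xy.
  by rewrite (hphi x y) // (hpsi x y).
- apply/fin_num_measure/(@trial_event_measurable _ _ _ _ _ m) => x y xy.
  by rewrite (hphi x y) // (hpsi x y).
rewrite -measureU.
- congr (fine (P _)); apply/seteqP; split => t; rewrite /trial_event /=.
    by move=> ->; case: (psi _); [left | right].
  by case=> /andP[].
- apply/(@trial_event_measurable _ _ _ _ _ m) => x y xy.
  by rewrite (hphi x y) // (hpsi x y).
- apply/(@trial_event_measurable _ _ _ _ _ m) => x y xy.
  by rewrite (hphi x y) // (hpsi x y).
- apply/seteqP; split => // t [] /=; rewrite /trial_event /=.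
  by move=> /andP[_ ->] /andP[].
Qed.

Lemma trial_prob_success (R : realType) (d : measure_display)
    (T : measurableType d) (P : probability T R) (X : nat -> {RV P >-> bool})
    (p : R) (hp : 0 < p < 1)
    (Xbernoulli : forall i,
       distribution P (X i) = bernoulli_prob p :> (set bool -> \bar R))
    (Xindep : mutually_independent X)
    (m : nat) (phi : (nat -> bool) -> bool) :
  determined_by_first m phi ->
  trial_prob X (fun x => phi x && x m) = trial_prob X phi * p.
Proof.
move=> h.
have Pm : P (X m @^-1` [set true]) = p%:E.
  have /andP[p0 p1] := hp.
  have := congr1 (fun f => f [set true]) (Xbernoulli m).
  rewrite /distribution /pushforward /= => ->.
  by rewrite /bernoulli_prob (ltW p0) (ltW p1) /= fsbig_set1.
have := @trial_event_independent _ _ _ _ _ Xindep m phi [fset m]%fset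
  (fun=> [set true]) h.
rewrite set_fset1 bigcap_set1 big_seq_fset1 Pm => indep.
rewrite /trial_prob.
have -> : trial_event X (fun x => phi x && x m) =
          trial_event X phi `&` X m @^-1` [set true].
  by apply/seteqP; split => t; rewrite /trial_event /=;
    [move/andP => [-> ->] | move=> [-> ->]].
rewrite indep; last by move=> i; rewrite inE => /eqP ->.
by rewrite fineM // fin_num_measure //; apply: trial_event_measurable h.
Qed.

(** The complement of [trial_prob_success] within the event phi. *)
Lemma trial_prob_failure (R : realType) (d : measure_display)
    (T : measurableType d) (P : probability T R) (X : nat -> {RV P >-> bool})
    (p : R) (hp : 0 < p < 1)
    (Xbernoulli : forall i,
       distribution P (X i) = bernoulli_prob p :> (set bool -> \bar R))
    (Xindep : mutually_independent X)
    (m : nat) (phi : (nat -> bool) -> bool) :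
  determined_by_first m phi ->
  trial_prob X (fun x => phi x && ~~ x m) = trial_prob X phi * (1 - p).
Proof.
move=> h; rewrite mulrBr mulr1 -(trial_prob_success hp Xbernoulli Xindep h).
have h' : determined_by_first m.+1 phi by exact: determined_by_firstW h.
have hm : determined_by_first m.+1 (fun x => x m) by move=> x y; apply.
by rewrite (trial_prob_split X h' hm) addrC addKr.
Qed.

(** * The evolution of the run state *)

Lemma run_state_determined (k m : nat) (f : pred (nat * nat)) :
  determined_by_first m (fun x => f (run_state k x m)).
Proof.
move=> x y xy; congr (f _); elim: m xy => //= m IHm xy.
by rewrite IHm ?xy // => i im; apply/xy/ltnW.
Qed.

Lemma run_state_streak (k : nat) (x : nat -> bool) (m c l : nat) :
  (l.+1 < k)%N ->
  (run_state k x m.+1 == (c, l.+1)) = (run_state k x m == (c, l)) && x m.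
Proof.
move=> lk /=; case: (run_state k x m) => c' l'; case: (x m); last first.
  by rewrite andbF xpair_eqE andbF.
by case: (l'.+1 =P k) => e; rewrite !xpair_eqE; lia.
Qed.

Lemma run_state_reset (k : nat) (x : nat -> bool) (m c : nat) :
  (0 < k)%N ->
  (run_state k x m.+1 == (c, 0%N)) =
  if x m then (0 < c)%N && (run_state k x m == (c.-1, k.-1))
  else nb_runs k x m == c.
Proof.
move=> k0 /=; rewrite /nb_runs; case: (run_state k x m) => c' l' /=.
case: (x m); last by rewrite xpair_eqE andbT.
by case: (l'.+1 =P k) => e; rewrite !xpair_eqE; lia.
Qed.

Lemma nb_runsS (k : nat) (x : nat -> bool) (m : nat) : (0 < k)%N ->
  nb_runs k x m.+1 =
  (nb_runs k x m + ((run_state k x m).2 == k.-1) && x m)%N.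
Proof.
move=> k0; rewrite /nb_runs /=; case: (run_state k x m) => c' l' /=.
by case: (x m); case: (l'.+1 =P k) => e /=; lia.
Qed.

Lemma nb_runs_homo (k : nat) (x : nat -> bool) : (0 < k)%N ->
  {homo nb_runs k x : m n / (m <= n)%N}.
Proof.
move=> k0; apply: homo_leq => [//|a b c|m]; first exact: leq_trans.
by rewrite nb_runsS // leq_addr.
Qed.

(** The number of completed runs is nondecreasing and grows by at most one per
    trial, so the first time it reaches r is the time it jumps from r.-1 to r. *)
Lemma run_waiting_timeS (k r n : nat) (x : nat -> bool) : (0 < k)%N -> (0 < r)%N ->
  run_waiting_time k r x = Some n.+1 <->
  (run_state k x n == (r.-1, k.-1)) && x n.
Proof.
move=> k0 r0.
have -> : (run_state k x n == (r.-1, k.-1)) && x n =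
          (nb_runs k x n < r <= nb_runs k x n.+1)%N.
  rewrite nb_runsS // /nb_runs; case: (run_state k x n) => c l /=.
  by rewrite xpair_eqE; case: (x n); rewrite ?andbF ?andbT; lia.
rewrite /run_waiting_time; case: pselect => [h|h]; last first.
  by split => // /andP[_ ?]; case: h; exists n.+1.
case: ex_minnP => m hm min_m; split.
  move=> [mn]; rewrite -mn hm andbT ltnNge; apply/negP => /min_m.
  by rewrite mn ltnn.
move=> /andP[lt_n le_n]; congr Some; apply/eqP; rewrite eqn_leq min_m //=.
rewrite ltnNge; apply/negP => mn.
by have := leq_trans hm (nb_runs_homo x k0 mn); rewrite leqNgt lt_n.
Qed.

(** * The distribution of the waiting time *)

(** A current streak of length l < k consists of the last l trials, all successful,
    preceded by a fresh start. *)
Lemma run_state_streak_prob (R : realType) (d : measure_display)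
    (T : measurableType d) (P : probability T R) (X : nat -> {RV P >-> bool})
    (p : R) (hp : 0 < p < 1)
    (Xbernoulli : forall i,
       distribution P (X i) = bernoulli_prob p :> (set bool -> \bar R))
    (Xindep : mutually_independent X) (k m c l : nat) :
  (l < k)%N ->
  trial_prob X (fun x => run_state k x m == (c, l)) =
  if (l <= m)%N then
    p ^+ l * trial_prob X (fun x => run_state k x (m - l) == (c, 0%N))
  else 0.
Proof.
elim: l m => [|l IHl] m lk; first by rewrite expr0 mul1r subn0.
case: m => [|m].
  by rewrite trial_prob_pred0 // => x; rewrite /= xpair_eqE andbF.
have -> : trial_prob X (fun x => run_state k x m.+1 == (c, l.+1)) =
    trial_prob X (fun x => (run_state k x m == (c, l)) && x m).
  by apply: eq_trial_prob => x; exact: run_state_streak.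
rewrite (trial_prob_success hp Xbernoulli Xindep); last first.
  exact: (@run_state_determined k m (pred1 (c, l))).
rewrite IHl ?(ltnW lk) // ltnS subSS.
by case: leqP; rewrite ?mul0r // exprSr mulrAC.
Qed.

(** Completing a run takes a fresh start followed by k successes. *)
Lemma run_completion_prob (R : realType) (d : measure_display)
    (T : measurableType d) (P : probability T R) (X : nat -> {RV P >-> bool})
    (p : R) (hp : 0 < p < 1)
    (Xbernoulli : forall i,
       distribution P (X i) = bernoulli_prob p :> (set bool -> \bar R))
    (Xindep : mutually_independent X) (k m c : nat) :
  (0 < k)%N ->
  trial_prob X (fun x => (run_state k x m == (c, k.-1)) && x m) =
  if (k <= m.+1)%N then
    p ^+ k * trial_prob X (fun x => run_state k x (m.+1 - k) == (c, 0%N))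
  else 0.
Proof.
case: k => // k _; rewrite (trial_prob_success hp Xbernoulli Xindep); last first.
  exact: (@run_state_determined k.+1 m (pred1 (c, k))).
rewrite (run_state_streak_prob hp Xbernoulli Xindep) // ltnS subSS.
by case: leqP; rewrite ?mul0r // exprSr mulrAC.
Qed.

(** The probabilities of the run process satisfy the hypotheses of
    [run_recurrence_solution].  For the recurrence of v, both {nb_runs = b after m
    trials} and {nb_runs = b after m + 1 trials} are compared with their
    intersection: the first loses the completion of run b + 1, the second gains the
    completion of run b. *)
Lemma fresh_start_prob (R : realType) (d : measure_display)
    (T : measurableType d) (P : probability T R) (X : nat -> {RV P >-> bool})
    (p : R) (hp : 0 < p < 1)
    (Xbernoulli : forall i,
       distribution P (X i) = bernoulli_prob p :> (set bool -> \bar R))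
    (Xindep : mutually_independent X) (k n c : nat) :
  (0 < k)%N -> (c * k <= n)%N ->
  trial_prob X (fun x => run_state k x n == (c, 0%N)) =
  p ^+ (c * k) *
    \sum_(0 <= j < (n - c * k).+1)
     ((-1) ^+ (n - c * k - j) * p ^+ (n - c * k - j) *
      'C(c.+1, n - c * k - j)%:R *
      \sum_(0 <= i < (j %/ k.+1).+1)
        ((- ((1 - p) * p ^+ k)) ^+ i * 'C(c + i, c)%:R *
         'C(c + j - i * k, c + i)%:R)).
Proof.
move=> k0 cn.
pose u m b := trial_prob X (fun x => run_state k x m == (b, 0%N)).
pose v m b := trial_prob X (fun x => nb_runs k x m == b).
pose a m b := trial_prob X (fun x => (run_state k x m == (b, k.-1)) && x m).
have nb_det m b : determined_by_first m (fun x => nb_runs k x m == b).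
  exact: (@run_state_determined k m (fun s => s.1 == b)).
have prev m b : trial_prob X (fun x =>
    [&& x m, (0 < b)%N & run_state k x m == (b.-1, k.-1)]) = prev_or0 (a m) b.
  case: b => [|b] /=.
    by apply: trial_prob_pred0 => x; rewrite andbF.
  by apply: eq_trial_prob => x; rewrite andbC.
apply: (@run_recurrence_solution _ k p (1 - p) u v a) => //.
- move=> b; case: b => [|b]; first by apply: trial_prob_predT.
  by apply: trial_prob_pred0.
- move=> b; case: b => [|b]; first by apply: trial_prob_predT.
  by apply: trial_prob_pred0.
- by move=> m b; apply: run_completion_prob.
- move=> m b; rewrite /u (@trial_prob_split _ _ _ _ _ m.+1 _ (fun x => x m)).
  + rewrite addrC mulrC; congr (_ + _).
      rewrite -(trial_prob_failure hp Xbernoulli Xindep (nb_det m b)).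
      apply: eq_trial_prob => x; rewrite run_state_reset //.
      by case: (x m); rewrite ?andbF.
    rewrite -prev; apply: eq_trial_prob => x; rewrite run_state_reset //.
    by case: (x m); rewrite ?andbF ?andbT.
  + exact: (@run_state_determined k m.+1 (pred1 (b, 0%N))).
  + by move=> x y; apply.
- move=> m b; have nb_detS := determined_by_firstW (leqnSn m) (nb_det m b).
  rewrite /v (trial_prob_split X (nb_det m.+1 b) nb_detS).
  rewrite (trial_prob_split X nb_detS (nb_det m.+1 b)).
  have -> : a m b =
      trial_prob X (fun x => (nb_runs k x m == b) && (nb_runs k x m.+1 != b)).
    apply: eq_trial_prob => x; rewrite nb_runsS // /nb_runs.
    case: (run_state k x m) => c' l' /=; rewrite xpair_eqE.
    by case: (x m); rewrite ?andbF ?andbT; lia.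
  rewrite addrK -prev; congr (_ + _).
    by apply: eq_trial_prob => x; rewrite andbC.
  apply: eq_trial_prob => x; rewrite nb_runsS // /nb_runs.
  case: (run_state k x m) => c' l' /=; rewrite xpair_eqE.
  by case: (x m); rewrite ?andbF ?andbT /=; lia.
Qed.

Theorem mainTheorem9 (R : realType) (d : measure_display)
    (T : measurableType d) (P : probability T R)
    (k r : nat) (p q : R) (X : nat -> {RV P >-> bool})
    (hk : (1 <= k)%N) (hr : (1 <= r)%N)
    (hp : 0 < p < 1) (hq : q = 1 - p)
    (Xbernoulli : forall i, distribution P (X i) = bernoulli_prob p :> (set bool -> \bar R))
    (Xindep : mutually_independent X)
    (n : nat) (hn : (r * k <= n)%N) :
  P [set t | run_waiting_time k r (fun i => X i t) = Some n] =
  (p ^+ (r * k) *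
   \sum_(0 <= j < (n - r * k).+1)
     ((-1) ^+ (n - r * k - j) * p ^+ (n - r * k - j) *
      'C(r, n - r * k - j)%:R *
      \sum_(0 <= i < (j %/ (k + 1)).+1)
        ((-1) ^+ i * q ^+ i * p ^+ (i * k) *
         'C(r + i - 1, r - 1)%:R * 'C(r + j - i * k - 1, r + i - 1)%:R)))%:E.
Proof.
case: n hn => [|n] hn; first by move: hn; nia.
case: r hr hn => // c _ hn.
pose phi x := (run_state k x n == (c, k.-1)) && x n.
have phi_det : determined_by_first n.+1 phi.
  move=> x y xy; rewrite /phi xy //; congr (_ && _).
  apply: (@run_state_determined k n (pred1 (c, k.-1))) => i im.
  exact/xy/ltnW.
have -> : [set t | run_waiting_time k c.+1 (fun i => X i t) = Some n.+1] =
          trial_event X phi.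
  by apply/seteqP; split => t; rewrite /trial_event /=;
     move/(run_waiting_timeS _ _ hk (ltn0Sn c)).
rewrite -[LHS]fineK; last first.
  by apply/fin_num_measure/(trial_event_measurable _ phi_det).
congr EFin; rewrite -/(trial_prob X phi).
have kn : (k <= n.+1)%N by apply: leq_trans hn; rewrite leq_pmull.
have cn : (c * k <= n.+1 - k)%N by rewrite leq_subRL // -mulSn.
rewrite (run_completion_prob hp Xbernoulli Xindep) // kn.
rewrite (fresh_start_prob hp Xbernoulli Xindep) // mulrA -exprD -mulSn.
have -> : (n.+1 - k - c * k = n.+1 - c.+1 * k)%N by rewrite -subnDA -mulSn.
congr (_ * _); apply: eq_big_nat => j /andP[_ jn]; congr (_ * _).
rewrite addn1; apply: eq_big_nat => i /andP[_]; rewrite ltnS leq_divRL // => ij.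
rewrite -mulNr exprMn -exprM -mulN1r exprMn -hq [(k * i)%N]mulnC.
congr (_ * _%:R * 'C(_, _)%:R); rewrite ?subn1 //.
by rewrite addSn subSn ?subn1 //; lia.
Qed.
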